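(* Let $b\in\mathbb{C}$. For all $\lambda\in\mathbb{C}^*$, $\alpha\in\mathbb{C}$ and $\mathbf{h}\in\mathcal{H}_\alpha$, the formulas in the context defining $\Phi(\lambda,\alpha,\mathbf{h})=\mathbb{C}[s,t]$ make it a module over the Lie algebra $\mathcal{V}ir(0,b)$. Moreover, for all $\lambda\in\mathbb{C}^*$ and $\mathbf{r}\in\mathcal{H}_0$ (with $\mathcal{H}_0$ taken for $b=1$), the formulas in the context defining $\Theta(\lambda,\mathbf{r})=\mathbb{C}[s,t]$ make it a module over the Lie algebra $\mathcal{V}ir(0,1)$.
   Context: $\mathbb{C}^*$ denotes the nonzero complex numbers; $\delta_{x,y}$ is the Kronecker delta. The Lie algebras $\mathcal{V}ir(0,b)$, $b\in\mathbb{C}$, are complex Lie algebras with the following bases and brackets ($m,n\in\mathbb{Z}$); the elements $C_i$ are always central, and in all of them $[L_n,L_m]=(m-n)L_{m+n}+\delta_{m+n,0}\frac{n^3-n}{12}C_1$. $\bullet$ $\mathcal{V}ir(0,0)$: basis $\{L_n,W_n,C_1,C_2,C_3\mid n\in\mathbb{Z}\}$, $[L_n,W_m]=mW_{m+n}+\delta_{m+n,0}(n^2+n)C_2$, $[W_n,W_m]=n\delta_{m+n,0}C_3$. $\bullet$ $\mathcal{V}ir(0,-1)$: basis $\{L_n,W_n,C_1,C_2\mid n\in\mathbb{Z}\}$, $[L_n,W_m]=(m-n)W_{m+n}+\delta_{m+n,0}\frac{n^3-n}{12}C_2$, $[W_n,W_m]=0$. $\bullet$ $\mathcal{V}ir(0,1)$: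 basis $\{L_n,W_n,C_1,C_2,C_4\mid n\in\mathbb{Z}\}$, $[L_n,W_m]=(m+n)W_{m+n}+\delta_{m+n,0}(nC_2+C_4)$, $[W_n,W_m]=0$. $\bullet$ $\mathcal{V}ir(0,b)$ with $b\ne 0,\pm1$: basis $\{L_n,W_n,C_1\mid n\in\mathbb{Z}\}$, $[L_n,W_m]=(m+nb)W_{m+n}$, $[W_n,W_m]=0$. For $\alpha,b\in\mathbb{C}$, an integer $k\ge 0$ and $n\in\mathbb{Z}$, let $$q_{n,k;\alpha}(t)=nt^k-\delta_{b,-1}\,n(n-1)\alpha\frac{t^k-\alpha^k}{t-\alpha}-\delta_{b,1}\,n\alpha\frac{t^k-\alpha^k}{t-\alpha}\in\mathbb{C}[t],$$ and let $\mathcal{H}_\alpha$ (which depends also on $b$) be the set of all families $(h_n(t))_{n\in\mathbb{Z}}$ of polynomials of the form $h_n(t)=\sum_{i\ge 0}h^{(i)}q_{n,i;\alpha}(t)\in\mathbb{C}[t]$, where the $h^{(i)}\in\mathbb{C}$ are independent of $n$ and only finitely many are nonzero. For $\lambda\in\mathbb{C}^*$, $\alpha\in\mathbb{C}$ and $\mathbf{h}=(h_n(t))_{n\in\mathbb{Z}}\in\mathcal{H}_\alpha$, $\Phi(\lambda,\alpha,\mathbf{h})$ is the vector space $\mathbb{C}[s,t]$ with the following action of $\mathcal{V}ir(0,b)$: $$L_m\cdot f(s,t)=\lambda^m(s+h_m(t))f(s-m,t)+bm\lambda^m\bigl(t-\delta_{b,-1}m\alpha-\delta_{b,1}(1-\delta_{m,0})\alpha\bigr)\frac{\partial}{\partial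 t}\bigl(f(s-m,t)\bigr),$$ $$W_m\cdot f(s,t)=\lambda^m\bigl(t-\delta_{b,-1}m\alpha-\delta_{b,1}(1-\delta_{m,0})\alpha\bigr)f(s-m,t),$$ and every central basis element $C_i$ acts as $0$. For $b=1$, $\lambda\in\mathbb{C}^*$ and $\mathbf{r}=(r_n(t))_{n\in\mathbb{Z}}\in\mathcal{H}_0$, $\Theta(\lambda,\mathbf{r})$ is the vector space $\mathbb{C}[s,t]$ with the following action of $\mathcal{V}ir(0,1)$: $$L_m\cdot f(s,t)=\lambda^m(s+r_m(t))f(s-m,t),\qquad W_m\cdot f(s,t)=\delta_{m,0}\,t f(s-m,t),$$ and $C_1,C_2,C_4$ act as $0$. *)

(* Defs.v *)
From HB Require Import structures.
From mathcomp Require Import all_boot all_order all_algebra.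
From mathcomp Require Import ring.
From mathcomp.multinomials Require Import freeg mpoly.

Set Implicit Arguments.
Unset Strict Implicit.
Unset Printing Implicit Defensive.

Import Order.TTheory GRing.Theory Num.Theory.
Local Open Scope ring_scope.

Record lieAlgebra (F : fieldType) := LieAlgebra {
  lie_carrier :> lmodType F;
  lie_br : lie_carrier -> lie_carrier -> lie_carrier;
  lie_br_linear_l : forall y, linear (lie_br^~ y);
  lie_br_linear_r : forall x, linear (lie_br x);
  lie_br_alt : forall x, lie_br x x = 0;
  lie_br_jacobi : forall x y z,
    lie_br x (lie_br y z) + lie_br y (lie_br z x) + lie_br z (lie_br x y) = 0
}.

Definition is_lie_module (F : fieldType) (g : lieAlgebra F) (V : lmodType F)
    (act : g -> V -> V) : Prop :=
  [/\ forall v : V, linear (act^~ v),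
      forall x : g, linear (act x)
    & forall (x y : g) (v : V),
        act (lie_br x y) v = act x (act y v) - act y (act x v)].

Section Fglift.

Variables (F : fieldType) (K : choiceType).

Lemma scale_freegU (a k : F) (x : K) :
  a *: << k *g x >> = << a * k *g x >> :> {freeg K / F}.
Proof. by apply/eqP/freeg_eqP=> y; rewrite coeffZ !coeffU mulrA. Qed.

Lemma fglift_linear (V : lmodType F) (f : K -> V) :
  linear (fglift f : {freeg K / F} -> V).
Proof.
have fB := @lift_is_additive F K V f.
have f0 : fglift f 0 = 0 by have := fB 0 0; rewrite !subrr.
have fN x : fglift f (- x) = - fglift f x by rewrite -[- x]sub0r fB f0 sub0r.
have fD x y : fglift f (x + y) = fglift f x + fglift f y.
  by rewrite -[y in LHS]opprK fB fN opprK.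
move=> a x y; rewrite fD; congr (_ + _).
elim/freeg_ind_dom0: x => [|k u x _ _ IH]; first by rewrite scaler0 f0 scaler0.
by rewrite scalerDr scale_freegU !fD IH !liftU scalerDr scalerA.
Qed.

Lemma freeg_ext (V : lmodType F) (f g : {freeg K / F} -> V) :
  linear f -> linear g -> (forall k, f << k >> = g << k >>) -> f =1 g.
Proof.
move=> lf lg fg.
have f0 (h : {freeg K / F} -> V) : linear h -> h 0 = 0.
  by move=> lh; have := lh (-1) 0 0; rewrite !scaleN1r !addNr.
elim/freeg_ind_dom0 => [|k u x _ _ IH]; first by rewrite !f0.
by rewrite -[k]mulr1 -scale_freegU lf lg IH fg.
Qed.

Definition bilin_ext (br0 : K -> K -> {freeg K / F}) (x y : {freeg K / F}) :
    {freeg K / F} :=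
  fglift (fun u => fglift (br0 u) y) x.

Section BilinExt.

Variable br0 : K -> K -> {freeg K / F}.
Local Notation br := (bilin_ext br0).

Lemma bilin_extE u v : br << u >> << v >> = br0 u v.
Proof. by rewrite /bilin_ext !liftU !scale1r. Qed.

Lemma bilin_ext_linear_l y : linear (br^~ y).
Proof. exact: fglift_linear. Qed.

Lemma bilin_ext_linear_r x : linear (br x).
Proof.
move=> a y z; apply: (@freeg_ext _ (br^~ (a *: y + z))
  (fun x => a *: br x y + br x z)) => {x}.
- exact: bilin_ext_linear_l.
- move=> c x x' /=; rewrite !bilin_ext_linear_l !scalerDr !scalerA [a * c]mulrC.
  by rewrite addrACA.
- by move=> k; rewrite /bilin_ext !liftU !scale1r fglift_linear.
Qed.

Let brDl x x' y : br (x + x') y = br x y + br x' y.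
Proof. by have := bilin_ext_linear_l y 1 x x'; rewrite !scale1r. Qed.
Let brDr x y y' : br x (y + y') = br x y + br x y'.
Proof. by have := bilin_ext_linear_r x 1 y y'; rewrite !scale1r. Qed.
Let br0l y : br 0 y = 0.
Proof. by apply: (@addrI _ (br 0 y)); rewrite -brDl !addr0. Qed.
Let br0r x : br x 0 = 0.
Proof. by apply: (@addrI _ (br x 0)); rewrite -brDr !addr0. Qed.
Let brZl c x y : br (c *: x) y = c *: br x y.
Proof. by have := bilin_ext_linear_l y c x 0; rewrite br0l !addr0. Qed.
Let brZr c x y : br x (c *: y) = c *: br x y.
Proof. by have := bilin_ext_linear_r x c y 0; rewrite br0r !addr0. Qed.

Lemma bilin_ext_skew :
  (forall u v, br0 u v = - br0 v u) -> forall x y, br x y = - br y x.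
Proof.
move=> skew x y; apply: (@freeg_ext _ (br^~ y) (fun x => - br y x)) => {x}.
- exact: bilin_ext_linear_l.
- by move=> c x x' /=; rewrite brDr brZr opprD scalerN.
move=> u /=; apply: (@freeg_ext _ (br << u >>) (fun y => - br y << u >>)) => {y}.
- exact: bilin_ext_linear_r.
- by move=> c x x' /=; rewrite brDl brZl opprD scalerN.
by move=> v; rewrite !bilin_extE.
Qed.

Lemma bilin_ext_jacobi :
  (forall u v w, br << u >> (br0 v w) + br << v >> (br0 w u)
                 + br << w >> (br0 u v) = 0) ->
  forall x y z, br x (br y z) + br y (br z x) + br z (br x y) = 0.
Proof.
pose J x y z := br x (br y z) + br y (br z x) + br z (br x y).
have rot x y z : J x y z = J y z x by rewrite /J -[LHS]addrA addrC.
have lin y z : linear (fun x => J x y z).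
  move=> c x x'; rewrite /J !(brDl, brDr, brZl, brZr) !scalerDr.
  by rewrite [X in X + _ = _]addrACA [LHS]addrACA.
have lin0 : linear (fun _ : {freeg K / F} => 0 : {freeg K / F}).
  by move=> c x x'; rewrite scaler0 addr0.
have redJ (y z : {freeg K / F}) :
    (forall u, J << u >> y z = 0) -> forall x, J x y z = 0.
  by move=> J0; apply: (freeg_ext (lin y z) lin0).
move=> jac; rewrite -/J => x y z; apply: (redJ) => {x} u; rewrite rot.
apply: (redJ) => {y} v; rewrite rot; apply: (redJ) => {z} w.
by rewrite rot /J !bilin_extE.
Qed.

End BilinExt.

End Fglift.

(* The indices [i] of the central elements [C_i] in the basis of [Vir(0,b)]. *)
Definition central_ids (F : numFieldType) (b : F) : seq nat :=
  if b == 0 then [:: 1; 2; 3]%N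
  else if b == -1 then [:: 1; 2]%N
  else if b == 1 then [:: 1; 2; 4]%N
  else [:: 1]%N.

Variant vir_basis (F : numFieldType) (b : F) :=
  | bL of int
  | bW of int
  | bC of seq_sub (central_ids b).

Arguments bL {F b} _.
Arguments bW {F b} _.
Arguments bC {F b} _.

Section VirBasisChoice.

Variables (F : numFieldType) (b : F).

Definition vir_basis_encode (x : vir_basis b) :
    int + int + seq_sub (central_ids b) :=
  match x with bL n => inl (inl n) | bW n => inl (inr n) | bC i => inr i end.

Definition vir_basis_decode (x : int + int + seq_sub (central_ids b)) :
    vir_basis b :=
  match x with inl (inl n) => bL n | inl (inr n) => bW n | inr i => bC i end.

Lemma vir_basis_encodeK : cancel vir_basis_encode vir_basis_decode.
Proof. by case. Qed.

HB.instance Definition _ :=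
  Choice.copy (vir_basis b) (can_type vir_basis_encodeK).

End VirBasisChoice.

Section Vir.

Variables (F : numFieldType) (b : F).

Local Notation V := {freeg (vir_basis b) / F}.

Definition vL (n : int) : V := << bL n >>.
Definition vW (n : int) : V := << bW n >>.

(* [C_i], or [0] when [C_i] is not in the basis for this [b]; the brackets
   below only use it for [C_i] in the basis. *)
Definition vC (i : nat) : V :=
  oapp (fun j : seq_sub (central_ids b) => << bC j >>) 0 (insub i).

Definition br_LL (n m : int) : V :=
  (m - n)%:~R *: vL (m + n)
  + ((m + n == 0)%:R * ((n ^+ 3 - n)%:~R / 12)) *: vC 1.

Definition br_LW (n m : int) : V :=
  if b == 0 then
    m%:~R *: vW (m + n) + ((m + n == 0)%:R * (n ^+ 2 + n)%:~R) *: vC 2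
  else if b == -1 then
    (m - n)%:~R *: vW (m + n)
    + ((m + n == 0)%:R * ((n ^+ 3 - n)%:~R / 12)) *: vC 2
  else if b == 1 then
    (m + n)%:~R *: vW (m + n)
    + (m + n == 0)%:R *: (n%:~R *: vC 2 + vC 4)
  else (m%:~R + n%:~R * b) *: vW (m + n).

Definition br_WW (n m : int) : V :=
  if b == 0 then (n%:~R * (m + n == 0)%:R) *: vC 3 else 0.

Definition br_basis (x y : vir_basis b) : V :=
  match x, y with
  | bL n, bL m => br_LL n m
  | bL n, bW m => br_LW n m
  | bW m, bL n => - br_LW n m
  | bW n, bW m => br_WW n m
  | bC _, _ | _, bC _ => 0
  end.

Local Notation br := (bilin_ext br_basis).

Let brDr x y z : br x (y + z) = br x y + br x z.
Proof. by have := bilin_ext_linear_r br_basis x 1 y z; rewrite !scale1r. Qed.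
Let br0r x : br x 0 = 0.
Proof. by apply: (@addrI _ (br x 0)); rewrite -brDr !addr0. Qed.
Let brZr x c y : br x (c *: y) = c *: br x y.
Proof. by have := bilin_ext_linear_r br_basis x c y 0; rewrite br0r !addr0. Qed.
Let brNr x y : br x (- y) = - br x y.
Proof. by rewrite -scaleN1r brZr scaleN1r. Qed.

Let brC u i : br << u >> (vC i) = 0.
Proof.
rewrite /vC; case: insub => [j|] /=; last exact: br0r.
by rewrite bilin_extE; case: u.
Qed.

Let brLL n m : br << bL n >> (vL m) = br_LL n m.
Proof. by rewrite bilin_extE. Qed.
Let brLW n m : br << bL n >> (vW m) = br_LW n m.
Proof. by rewrite bilin_extE. Qed.
Let brWL n m : br << bW m >> (vL n) = - br_LW n m.
Proof. by rewrite bilin_extE. Qed.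
Let brWW n m : br << bW n >> (vW m) = br_WW n m.
Proof. by rewrite bilin_extE. Qed.

Lemma br_basis_skew u v : br_basis u v = - br_basis v u.
Proof.
case: u v => [n|n|i] [m|m|j] /=; rewrite ?opprK ?oppr0 //.
- rewrite /br_LL opprD -!scaleNr [n + m]addrC.
  congr (_ *: _ + _ *: _); first by ring.
  case: eqP => [/(canRL (addrK _))->|_]; last by rewrite /=; ring.
  by rewrite sub0r; ring.
- rewrite /br_WW; case: ifP => _; last by rewrite oppr0.
  rewrite -scaleNr [n + m]addrC; congr (_ *: _).
  case: eqP => [/(canRL (addrK _))->|_]; last by rewrite /=; ring.
  by rewrite sub0r; ring.
Qed.

Let comb2 (v w : V) (a1 a2 a3 c1 c2 c3 : F) :
  a1 + a2 + a3 = 0 -> c1 + c2 + c3 = 0 ->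
  (a1 *: v + c1 *: w) + (a2 *: v + c2 *: w) + (a3 *: v + c3 *: w) = 0.
Proof.
move=> ea ec; rewrite [X in X + _]addrACA [LHS]addrACA -!scalerDl ea ec.
by rewrite !scale0r addr0.
Qed.

Let jacobi_at (u v w : vir_basis b) :=
  br << u >> (br_basis v w) + br << v >> (br_basis w u)
  + br << w >> (br_basis u v) = 0.

Let jacobi_rot u v w : jacobi_at v w u -> jacobi_at u v w.
Proof. by move=> E; rewrite /jacobi_at -[LHS]addrA addrC. Qed.

Let jacobi_C i u v : jacobi_at (bC i) u v.
Proof.
have brCl x : br << bC i >> x = 0.
  apply: (@freeg_ext _ _ _ (br << bC i >>) (fun=> 0)) => {x}.
  - exact: bilin_ext_linear_r.
  - by move=> c x y; rewrite scaler0 addr0.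
  - by move=> k; rewrite bilin_extE.
rewrite /jacobi_at brCl add0r.
have -> : br_basis v (bC i) = 0 by case: v.
by rewrite /= !br0r addr0.
Qed.

Let jacobi_LLL n m p : jacobi_at (bL n) (bL m) (bL p).
Proof.
rewrite /jacobi_at /= /br_LL !(brDr, brZr, brC, scaler0, addr0) !brLL.
rewrite /br_LL.
have -> : n + p + m = p + m + n by ring.
have -> : m + n + p = p + m + n by ring.
rewrite !scalerDr !scalerA; apply: comb2; first by ring.
case: eqP => [/(canRL (addKr _))->|_]; last by rewrite /=; ring.
by field.
Qed.

Let comb3 (v w w' : V) (a1 a2 a3 c1 c2 c3 d1 d2 d3 : F) :
  a1 + a2 + a3 = 0 -> c1 + c2 + c3 = 0 -> d1 + d2 + d3 = 0 ->
  (a1 *: v + (c1 *: w + d1 *: w')) + (a2 *: v + (c2 *: w + d2 *: w'))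
  + (a3 *: v + (c3 *: w + d3 *: w')) = 0.
Proof.
move=> ea ec ed; rewrite [X in X + _]addrACA [LHS]addrACA -!scalerDl ea.
by rewrite scale0r add0r; apply: comb2.
Qed.

Let jacobi_LLW n m p : jacobi_at (bL n) (bL m) (bW p).
Proof.
rewrite /jacobi_at /= brNr /br_LL !(brDr, brZr, brC, scaler0, addr0) brWL.
have e1 : p + n + m = p + m + n by ring.
have e2 : p + (m + n) = p + m + n by ring.
case: (boolP (b == 0)) => [b0|b0].
  have LW i j : br_LW i j =
      j%:~R *: vW (j + i) + ((j + i == 0)%:R * (i ^+ 2 + i)%:~R) *: vC 2.
    by rewrite /br_LW b0.
  rewrite !LW !(brDr, brZr, brC, scaler0, addr0) !brLW !LW e1 e2.
  rewrite !(scalerN, scalerDr, scalerA, opprD) -!scaleNr.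
  apply: comb2; first by ring.
  case: eqP => [E|_]; last by rewrite /=; ring.
  by have -> : p = - m - n; [rewrite -[p]subr0 -E; ring | ring].
case: (boolP (b == -1)) => [b1|b1].
  have LW i j : br_LW i j = (j - i)%:~R *: vW (j + i)
      + ((j + i == 0)%:R * ((i ^+ 3 - i)%:~R / 12)) *: vC 2.
    by rewrite /br_LW (negbTE b0) b1.
  rewrite !LW !(brDr, brZr, brC, scaler0, addr0) !brLW !LW e1 e2.
  rewrite !(scalerN, scalerDr, scalerA, opprD) -!scaleNr.
  apply: comb2; first by ring.
  case: eqP => [E|_]; last by rewrite /=; ring.
  by have -> : p = - m - n; [rewrite -[p]subr0 -E; ring | field].
case: (boolP (b == 1)) => [b2|b2].
  have LW i j : br_LW i j = (j + i)%:~R *: vW (j + i)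
      + (((j + i == 0)%:R * i%:~R) *: vC 2 + (j + i == 0)%:R *: vC 4).
    by rewrite /br_LW (negbTE b0) (negbTE b1) b2 scalerDr scalerA.
  rewrite !LW !(brDr, brZr, brC, scaler0, addr0) !brLW !LW e1 e2.
  rewrite !(scalerN, scalerDr, scalerA, opprD) -!scaleNr.
  apply: comb3; first by ring.
    case: eqP => [E|_]; last by rewrite /=; ring.
    by have -> : p = - m - n; [rewrite -[p]subr0 -E; ring | ring].
  case: eqP => [E|_]; last by rewrite /=; ring.
  by have -> : p = - m - n; [rewrite -[p]subr0 -E; ring | ring].
have LW i j : br_LW i j = (j%:~R + i%:~R * b) *: vW (j + i) + 0 *: 0.
  by rewrite /br_LW (negbTE b0) (negbTE b1) (negbTE b2) scaler0 addr0.
rewrite !LW !(brDr, brZr, brC, br0r, scaler0, addr0) !brLW !LW e1 e2.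
rewrite -!scaleNr !scaler0 !addr0 ?scalerN !scalerA -?scaleNr -!scalerDl.
by rewrite -[RHS](scale0r (vW (p + m + n))); congr (_ *: _); ring.
Qed.

Let jacobi_LWW n m p : jacobi_at (bL n) (bW m) (bW p).
Proof.
have brLWW i j k : br << bL i >> (br_WW j k) = 0.
  by rewrite /br_WW; case: ifP => _; rewrite ?br0r // brZr brC scaler0.
rewrite /jacobi_at /= brLWW add0r brNr.
have [b0|b0] := boolP (b == 0).
  have LW i j : br_LW i j =
      j%:~R *: vW (j + i) + ((j + i == 0)%:R * (i ^+ 2 + i)%:~R) *: vC 2.
    by rewrite /br_LW b0.
  rewrite !LW !(brDr, brZr, brC, scaler0, addr0) !brWW /br_WW b0.
  have -> : m + n + p = p + n + m by ring.
  rewrite !scalerA -scaleNr -scalerDl -[RHS](scale0r (vC 3)).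
  congr (_ *: _); case: eqP => [E|_]; last by rewrite /=; ring.
  by have -> : p = - m - n; [rewrite -[p]subr0 -E; ring | ring].
have brWLW i j k : br << bW i >> (br_LW j k) = 0.
  rewrite /br_LW (negbTE b0).
  have WW l : br << bW i >> (vW l) = 0 by rewrite brWW /br_WW (negbTE b0).
  by do 2?case: ifP => _;
     rewrite !(brDr, brZr, brC, WW, scaler0, addr0).
by rewrite !brWLW oppr0 addr0.
Qed.

Let jacobi_WWW n m p : jacobi_at (bW n) (bW m) (bW p).
Proof.
have brW_WW i j k : br << bW i >> (br_WW j k) = 0.
  by rewrite /br_WW; case: ifP => _; rewrite ?br0r // brZr brC scaler0.
by rewrite /jacobi_at /= !brW_WW !addr0.
Qed.

Lemma br_basis_jacobi u v w : jacobi_at u v w.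
Proof.
case: u v w => [n|n|i] [m|m|j] [p|p|k]; do ?[exact: jacobi_C |
  exact: jacobi_LLL | exact: jacobi_LLW | exact: jacobi_LWW |
  exact: jacobi_WWW | apply: jacobi_rot].
Qed.

Lemma vir_br_alt x : br x x = 0.
Proof.
have /eqP := bilin_ext_skew br_basis_skew x x.
rewrite -addr_eq0 -mulr2n -scaler_nat scaler_eq0 pnatr_eq0 /=.
by move/eqP.
Qed.

Definition vir : lieAlgebra F :=
  LieAlgebra (bilin_ext_linear_l br_basis) (bilin_ext_linear_r br_basis)
    vir_br_alt (bilin_ext_jacobi br_basis_jacobi).

End Vir.
Section Modules.

Variables (F : numFieldType) (b : F).

Local Notation Fst := {mpoly F[2]}.

Definition s_var : Fst := 'X_0.
Definition t_var : Fst := 'X_1.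

Definition poly_in_t (p : {poly F}) : Fst := horner_alg t_var p.

(* [f(s - m, t)] *)
Definition shift_s (m : int) (f : Fst) : Fst :=
  f \mPo [tuple s_var - (m%:~R)%:MP; t_var].

(* The division in [d] is exact. *)
Definition q_poly (alpha : F) (n : int) (k : nat) : {poly F} :=
  let d := ('X^k - (alpha ^+ k)%:P) %/ ('X - alpha%:P) in
  n%:~R *: 'X^k
  - ((b == -1)%:R * (n * (n - 1))%:~R * alpha) *: d
  - ((b == 1)%:R * n%:~R * alpha) *: d.

Definition in_H (alpha : F) (h : int -> {poly F}) : Prop :=
  exists (N : nat) (c : nat -> F),
    forall n : int, h n = \sum_(i < N) c i *: q_poly alpha n i.

(* [t - delta_{b,-1} m alpha - delta_{b,1} (1 - delta_{m,0}) alpha] *)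
Definition t_shifted (alpha : F) (m : int) : Fst :=
  t_var - ((b == -1)%:R * m%:~R * alpha)%:MP
  - ((b == 1)%:R * (1 - (m == 0)%:R) * alpha)%:MP.

(* Linear extension to [Vir(0,b)] of an action given on the basis. *)
Definition extend_act (a : vir_basis b -> Fst -> Fst) (x : vir b) (f : Fst) :
    Fst :=
  fglift (a^~ f) x.

Definition Phi_basis (lambda alpha : F) (h : int -> {poly F})
    (u : vir_basis b) (f : Fst) : Fst :=
  match u with
  | bL m =>
      lambda ^ m *: ((s_var + poly_in_t (h m)) * shift_s m f)
      + (b * m%:~R * lambda ^ m)
          *: (t_shifted alpha m * (shift_s m f)^`M(1))
  | bW m => lambda ^ m *: (t_shifted alpha m * shift_s m f)
  | bC _ => 0
  end.

Definition Phi_act (lambda alpha : F) (h : int -> {poly F}) :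
    vir b -> Fst -> Fst :=
  extend_act (Phi_basis lambda alpha h).

End Modules.

Definition Theta_basis (F : numFieldType) (lambda : F) (r : int -> {poly F})
    (u : vir_basis (1 : F)) (f : {mpoly F[2]}) : {mpoly F[2]} :=
  match u with
  | bL m => lambda ^ m *: ((s_var F + poly_in_t (r m)) * shift_s m f)
  | bW m => (m == 0)%:R *: (t_var F * shift_s m f)
  | bC _ => 0
  end.

Definition Theta_act (F : numFieldType) (lambda : F) (r : int -> {poly F}) :
    vir (1 : F) -> {mpoly F[2]} -> {mpoly F[2]} :=
  extend_act (Theta_basis lambda r).

(* Main.v *)
Require Import Defs.
From mathcomp Require Import all_boot all_order all_algebra.
From mathcomp Require Import reals complex ring.
From mathcomp.multinomials Require Import freeg mpoly.

Import Order.TTheory GRing.Theory Num.Theory.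
Local Open Scope ring_scope.

(** Write [sigma_m f = f(s - m, t)] and [T_m] for the linear factor of [W_m].
    As [sigma_m] is a ring morphism that fixes [t] and commutes with [d/dt],
    the commutators of the [L_n] and [W_m] expand to the required ones as soon as
      [m T_m + b n T_n = (m + n b) T_(m+n)]   and
      [m h_m - n h_n + b (n T_n h_m' - m T_m h_n') = (m - n) h_(m+n)].
    For the second, put [H = sum_i h^(i) t^i], [D = (H - H(alpha)) / (t - alpha)];
    then [h_n] is a combination of [H] and [D], and [H' = D + (t - alpha) D']. *)

(** * Reduction of the module axioms to the basis of the Lie algebra *)

Section BasisExtension.

Variables (F : numFieldType) (b : F).
Local Notation M := {mpoly F[2]}.
Variable a : vir_basis b -> M -> M.

Lemma extend_act_linear_l f : linear ((extend_act a)^~ f).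
Proof. exact: fglift_linear. Qed.

Lemma extend_actU u f : extend_act a << u >> f = a u f.
Proof. by rewrite /extend_act liftU scale1r. Qed.

Lemma extend_act0l f : extend_act a 0 f = 0.
Proof.
have := extend_act_linear_l f (-1) 0 0.
by rewrite !scaleN1r !addNr.
Qed.

Lemma extend_actDl f x y :
  extend_act a (x + y) f = extend_act a x f + extend_act a y f.
Proof. by have := extend_act_linear_l f 1 x y; rewrite !scale1r. Qed.

Lemma extend_actZl f c x : extend_act a (c *: x) f = c *: extend_act a x f.
Proof.
by have := extend_act_linear_l f c x 0; rewrite extend_act0l !addr0.
Qed.

Lemma extend_actNl f x : extend_act a (- x) f = - extend_act a x f.
Proof. by rewrite -scaleN1r extend_actZl scaleN1r. Qed.

Hypothesis a_linear : forall u, linear (a u).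

Lemma extend_act_linear_r x : linear (extend_act a x).
Proof.
move=> c f g; apply: (@freeg_ext _ _ _ ((extend_act a)^~ (c *: f + g))
  (fun x => c *: extend_act a x f + extend_act a x g)) => {x}.
- exact: extend_act_linear_l.
- move=> k x y; rewrite !extend_actDl !extend_actZl !scalerDr !scalerA.
  by rewrite [c * k]mulrC addrACA.
- by move=> u; rewrite !extend_actU a_linear.
Qed.

(** Both sides of the bracket axiom are linear in [x] and in [y], so [freeg_ext], applied to each
    argument in turn, leaves only pairs of basis elements. *)
Lemma extend_act_lie_module :
  (forall u v f, extend_act a (br_basis u v) f = a u (a v f) - a v (a u f)) ->
  is_lie_module (extend_act a).
Proof.
move=> a_br; split; [exact: extend_act_linear_l|exact: extend_act_linear_r|].
have actDr x f g : extend_act a x (f + g) = extend_act a x f + extend_act a x g.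
  by have := extend_act_linear_r x 1 f g; rewrite !scale1r.
have act0r x : extend_act a x 0 = 0.
  by apply: (@addrI _ (extend_act a x 0)); rewrite -actDr !addr0.
have actZr x c f : extend_act a x (c *: f) = c *: extend_act a x f.
  by have := extend_act_linear_r x c f 0; rewrite act0r !addr0.
have comm_lin (k : F) (p p' q q' : M) :
    k *: p + p' - (k *: q + q') = k *: (p - q) + (p' - q').
  by rewrite scalerBr opprD addrACA.
move=> x y f; apply: (@freeg_ext _ _ _
  (fun x => extend_act a (bilin_ext (@br_basis F b) x y) f)
  (fun x => extend_act a x (extend_act a y f) -
            extend_act a y (extend_act a x f))) => {x}.
- move=> c x x'; rewrite bilin_ext_linear_l.
  by rewrite extend_actDl extend_actZl.
- move=> c x x'.
  by rewrite !extend_actDl !extend_actZl actDr actZr comm_lin.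
move=> u; apply: (@freeg_ext _ _ _
  (fun y => extend_act a (bilin_ext (@br_basis F b) << u >> y) f)
  (fun y => extend_act a << u >> (extend_act a y f) -
            extend_act a y (extend_act a << u >> f))) => {y}.
- move=> c y y'; rewrite bilin_ext_linear_r.
  by rewrite extend_actDl extend_actZl.
- move=> c y y'.
  by rewrite !extend_actDl !extend_actZl actDr actZr comm_lin.
by move=> v; rewrite bilin_extE a_br !extend_actU.
Qed.

Hypothesis a_central : forall i f, a (bC i) f = 0.

Lemma extend_act_vC i f : extend_act a (vC b i) f = 0.
Proof.
rewrite /vC; case: insub => [j|] /=; last exact: extend_act0l.
by rewrite extend_actU a_central.
Qed.

Lemma extend_act_br_LL n m f :
  extend_act a (br_LL b n m) f = (m - n)%:~R *: a (bL (m + n)) f.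
Proof.
rewrite /br_LL extend_actDl !extend_actZl extend_act_vC scaler0 addr0.
by rewrite extend_actU.
Qed.

(** Once the central elements act as zero, the four cases of the bracket agree: at [b = 0], [-1],
    [1] the factor [m + n b] is [m], [m - n], [m + n]. *)
Lemma extend_act_br_LW n m f :
  extend_act a (br_LW b n m) f = (m%:~R + n%:~R * b) *: a (bW (m + n)) f.
Proof.
rewrite /br_LW; case: eqP => [b0|_].
  rewrite extend_actDl !extend_actZl extend_act_vC scaler0 addr0 extend_actU.
  by congr (_ *: _); rewrite b0 mulr0 addr0.
case: eqP => [b1|_].
  rewrite extend_actDl !extend_actZl extend_act_vC scaler0 addr0 extend_actU.
  by congr (_ *: _); rewrite b1 mulrN1 rmorphB.
case: eqP => [b1|_]; last by rewrite extend_actZl extend_actU.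
rewrite !(extend_actDl, extend_actZl) !extend_act_vC !(scaler0, addr0).
by rewrite extend_actU; congr (_ *: _); rewrite b1 mulr1 rmorphD.
Qed.

Lemma extend_act_br_WW n m f : extend_act a (br_WW b n m) f = 0.
Proof.
rewrite /br_WW; case: ifP => _; last exact: extend_act0l.
by rewrite extend_actZl extend_act_vC scaler0.
Qed.

(** Of the remaining pairs, [W, L] follows from [L, W] by antisymmetry, and every pair with a
    central element gives zero on both sides. *)
Lemma vir_module_of_basis :
  (forall n m f, a (bL n) (a (bL m) f) - a (bL m) (a (bL n) f)
                 = (m - n)%:~R *: a (bL (m + n)) f) ->
  (forall n m f, a (bL n) (a (bW m) f) - a (bW m) (a (bL n) f)
                 = (m%:~R + n%:~R * b) *: a (bW (m + n)) f) ->
  (forall n m f, a (bW n) (a (bW m) f) = a (bW m) (a (bW n) f)) ->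
  is_lie_module (extend_act a).
Proof.
move=> LL LW WW; apply: extend_act_lie_module => u v f.
have a0 w : a w 0 = 0.
  by have := a_linear w (-1) 0 0; rewrite !scaleN1r !addNr.
case: u v => [n|n|i] [m|m|j] /=; rewrite ?a_central ?a0 ?subrr ?extend_act0l //.
- by rewrite LL extend_act_br_LL.
- by rewrite LW extend_act_br_LW.
- by rewrite extend_actNl extend_act_br_LW -LW opprB.
- by rewrite extend_act_br_WW WW subrr.
Qed.

End BasisExtension.

(** * Shift and [t]-derivative on polynomials in [s] and [t] *)

Lemma mpoly_alg_ind {n : nat} {R : comNzRingType} (P : {mpoly R[n]} -> Prop) :
  (forall c, P c%:MP) -> (forall i, P 'X_i) ->
  (forall p q, P p -> P q -> P (p + q)) ->
  (forall p q, P p -> P q -> P (p * q)) -> forall p, P p.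
Proof.
move=> PC PX PD PM; elim/mpolyind => [|c m p _ _ Pp]; first by rewrite -mpolyC0.
apply: (PD) => //; rewrite -mul_mpolyC; apply: (PM) => //; rewrite mpolyXE_id.
apply: (@big_ind _ P) => [|p1 p2|i _]; [exact: (PC 1)|exact: PM|].
elim: (m i) => [|k Pk]; first exact: (PC 1).
by rewrite exprS; apply: PM.
Qed.

Section Operators.

Variable F : numFieldType.
Local Notation M := {mpoly F[2]}.
Local Notation dt p := (mderiv (1 : 'I_2) p).

Lemma shift_sZ m c (f : M) : shift_s m (c *: f) = c *: shift_s m f.
Proof. exact: linearZ. Qed.

Lemma shift_sD m (f g : M) : shift_s m (f + g) = shift_s m f + shift_s m g.
Proof. exact: comp_mpolyD. Qed.

Lemma shift_sM m (f g : M) : shift_s m (f * g) = shift_s m f * shift_s m g.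
Proof. exact: (rmorphM (comp_mpoly _)). Qed.

Lemma shift_sC m c : shift_s m (c%:MP : M) = c%:MP.
Proof. exact: comp_mpolyC. Qed.

Lemma shift_s_s m : shift_s m (s_var F) = s_var F - (m%:~R)%:MP.
Proof. by rewrite /shift_s comp_mpolyXU. Qed.

Lemma shift_s_t m : shift_s m (t_var F) = t_var F.
Proof. by rewrite /shift_s comp_mpolyXU. Qed.

(** The constants, [s] and [t] generate the algebra, so identities between ring morphisms, or
    between derivations composed with them, need only be checked on these generators. *)
Lemma mpoly_st_ind (P : M -> Prop) :
  (forall c, P c%:MP) -> P (s_var F) -> P (t_var F) ->
  (forall p q, P p -> P q -> P (p + q)) ->
  (forall p q, P p -> P q -> P (p * q)) -> forall p, P p.
Proof.
move=> PC Ps Pt PD PM; apply: mpoly_alg_ind => // i.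
(* The indices 0 and 1 come with arbitrary bound proofs; proof irrelevance identifies them with the
   indices of [s_var] and [t_var]. *)
by case: i => [[|[|k]] lti] //; rewrite (bool_irrelevance lti isT) in Ps Pt *.
Qed.

Lemma shift_s_shift_s m n (f : M) : shift_s m (shift_s n f) = shift_s (m + n) f.
Proof.
elim/mpoly_st_ind: f => [c|||p q IHp IHq|p q IHp IHq].
- by rewrite !shift_sC.
- rewrite !shift_s_s -mpolyCN shift_sD shift_s_s shift_sC; ring.
- by rewrite !shift_s_t.
- by rewrite !shift_sD IHp IHq.
- by rewrite !shift_sM IHp IHq.
Qed.

Lemma shift_s0 (f : M) : shift_s 0 f = f.
Proof.
elim/mpoly_st_ind: f => [c|||p q IHp IHq|p q IHp IHq].
- by rewrite !shift_sC.
- by rewrite shift_s_s subr0.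
- by rewrite shift_s_t.
- by rewrite shift_sD IHp IHq.
- by rewrite shift_sM IHp IHq.
Qed.

Lemma dt_s : dt (s_var F) = 0.
Proof. by rewrite mderivX mnm1E /= scale0r. Qed.

Lemma dt_t : dt (t_var F) = 1.
Proof.
rewrite mderivX mnm1E eqxx scale1r.
suff -> : (U_(1) - U_(1))%MM = 0%MM :> 'X_{1..2} by rewrite mpolyX0.
by apply/mnmP => i; rewrite mnmBE subnn mnm0E.
Qed.

Lemma dt_shift_s m (f : M) : dt (shift_s m f) = shift_s m (dt f).
Proof.
elim/mpoly_st_ind: f => [c|||p q IHp IHq|p q IHp IHq].
- by rewrite shift_sC mderivC -mpolyC0 shift_sC.
- by rewrite shift_s_s mderivB mderivC dt_s subr0 -mpolyC0 shift_sC.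
- by rewrite shift_s_t dt_t -mpolyC1 shift_sC.
- by rewrite shift_sD !mderivD shift_sD IHp IHq.
- by rewrite shift_sM !mderivM shift_sD !shift_sM IHp IHq.
Qed.

Lemma poly_in_tE c : poly_in_t (c%:P : {poly F}) = c%:MP.
Proof. by rewrite /poly_in_t horner_algC -mul_mpolyC mulr1. Qed.

Lemma poly_in_tX : poly_in_t ('X : {poly F}) = t_var F.
Proof. exact: horner_algX. Qed.

Lemma poly_in_tZ c (p : {poly F}) : poly_in_t (c *: p) = c%:MP * poly_in_t p.
Proof.
by rewrite -mul_polyC -poly_in_tE; apply: (rmorphM (horner_alg (t_var F))).
Qed.

Lemma poly_in_tM (p q : {poly F}) :
  poly_in_t (p * q) = poly_in_t p * poly_in_t q.
Proof. exact: (rmorphM (horner_alg (t_var F))). Qed.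

Lemma poly_in_tD (p q : {poly F}) :
  poly_in_t (p + q) = poly_in_t p + poly_in_t q.
Proof. exact: (rmorphD (horner_alg (t_var F))). Qed.

Lemma poly_in_tB (p q : {poly F}) :
  poly_in_t (p - q) = poly_in_t p - poly_in_t q.
Proof. exact: (rmorphB (horner_alg (t_var F))). Qed.

Lemma shift_s_poly_in_t m (p : {poly F}) :
  shift_s m (poly_in_t p) = poly_in_t p.
Proof.
elim/poly_ind: p => [|p c IHp].
  by rewrite -polyC0 poly_in_tE shift_sC.
rewrite poly_in_tD poly_in_tM poly_in_tX poly_in_tE.
by rewrite shift_sD shift_sM shift_sC shift_s_t IHp.
Qed.

Lemma dt_poly_in_t (p : {poly F}) : dt (poly_in_t p) = poly_in_t p^`().
Proof.
elim/poly_ind: p => [|p c IHp].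
  by rewrite linear0 /poly_in_t !rmorph0 mderiv0.
rewrite derivMXaddC !poly_in_tD !poly_in_tM poly_in_tX poly_in_tE.
by rewrite mderivD mderivM IHp dt_t mderivC mulr1 addr0 addrC.
Qed.

(* Otherwise failed matches of the rewrite rules unfold these and diverge. *)
#[local] Opaque mderiv shift_s poly_in_t s_var t_var.

(** * Commutators of the operators for abstract families [T] and [h] *)

Variables (b lambda : F) (T h : int -> {poly F}).

(** Leaving [T] and [h] abstract confines the case distinction on [b] to two identities in one
    variable, and lets [Theta] reuse the computation for its [L_m]. *)
Definition opL m (f : M) : M :=
  lambda ^ m *: ((s_var F + poly_in_t (h m)) * shift_s m f)
  + (b * m%:~R * lambda ^ m) *: (poly_in_t (T m) * dt (shift_s m f)).

Definition opW m (f : M) : M :=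
  lambda ^ m *: (poly_in_t (T m) * shift_s m f).

Lemma opL_linear m : linear (opL m).
Proof.
move=> c f g; rewrite /opL shift_sD shift_sZ mderivD mderivZ !mulrDr.
by rewrite -!scalerAr !scalerDr !scalerA ![_ * c]mulrC addrACA.
Qed.

Lemma opW_linear m : linear (opW m).
Proof.
move=> c f g; rewrite /opW shift_sD shift_sZ mulrDr -scalerAr scalerDr.
by rewrite !scalerA mulrC.
Qed.

Hypothesis lambda_neq0 : lambda != 0.

Lemma opW_comm n m f : opW n (opW m f) = opW m (opW n f).
Proof.
rewrite /opW !shift_sZ !shift_sM !shift_s_poly_in_t !shift_s_shift_s.
rewrite [m + n]addrC -!mul_mpolyC; ring.
Qed.

Hypothesis T_deriv : forall m, (T m)^`() = 1.

Hypothesis T_cond : forall n m,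
  m%:~R *: T m + (b * n%:~R) *: T n = (m%:~R + n%:~R * b) *: T (m + n).

Let dt_T m : dt (poly_in_t (T m)) = 1.
Proof. by rewrite dt_poly_in_t T_deriv -polyC1 poly_in_tE. Qed.

Let T_condM n m :
  (m%:~R)%:MP * poly_in_t (T m) + (b * n%:~R)%:MP * poly_in_t (T n)
  = (m%:~R + n%:~R * b)%:MP * poly_in_t (T (m + n)).
Proof.
by rewrite -!poly_in_tZ -T_cond poly_in_tD.
Qed.

Let shift_opW n m f :
  shift_s n (opW m f) = lambda ^ m *: (poly_in_t (T m) * shift_s (n + m) f).
Proof.
by rewrite /opW shift_sZ shift_sM shift_s_poly_in_t shift_s_shift_s.
Qed.

Let dt_shift_opW n m f :
  dt (shift_s n (opW m f))
  = lambda ^ m *: (shift_s (n + m) f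
                   + poly_in_t (T m) * dt (shift_s (n + m) f)).
Proof. by rewrite shift_opW mderivZ mderivM dt_T mul1r. Qed.

Let shift_opL n m f :
  shift_s n (opL m f)
  = lambda ^ m *: ((s_var F - (n%:~R)%:MP + poly_in_t (h m))
                   * shift_s (n + m) f)
    + (b * m%:~R * lambda ^ m)
        *: (poly_in_t (T m) * dt (shift_s (n + m) f)).
Proof.
rewrite /opL shift_sD; congr (_ + _).
  rewrite shift_sZ shift_sM (shift_sD n (s_var F)) shift_s_s.
  by rewrite shift_s_poly_in_t shift_s_shift_s.
rewrite shift_sZ shift_sM shift_s_poly_in_t -dt_shift_s.
by rewrite shift_s_shift_s.
Qed.

Let dt_shift_opL n m f :
  dt (shift_s n (opL m f))
  = lambda ^ m *: (poly_in_t (h m)^`() * shift_s (n + m) f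
      + (s_var F - (n%:~R)%:MP + poly_in_t (h m)) * dt (shift_s (n + m) f))
    + (b * m%:~R * lambda ^ m)
        *: (dt (shift_s (n + m) f)
            + poly_in_t (T m) * dt (dt (shift_s (n + m) f))).
Proof.
rewrite shift_opL mderivD 2!mderivZ 2!mderivM dt_T mul1r.
by rewrite (mderivD _ (_ - _)) mderivB dt_s mderivC subr0 add0r dt_poly_in_t.
Qed.

Lemma opL_opW n m f :
  opL n (opW m f) - opW m (opL n f)
  = (m%:~R + n%:~R * b) *: opW (m + n) f.
Proof.
have E := T_condM n m.
rewrite [opL n (opW m f)]/opL [opW m (opL n f)]/opW shift_opL.
rewrite dt_shift_opW shift_opW /opW [n + m]addrC expfzDr //.
rewrite -!mul_mpolyC.
apply: (@subr0_eq M).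
set f0 := shift_s _ f; set f1 := dt f0.
(* The terms in [s], [h n] and [f1] cancel. What remains is [m T_m], from the shift of [s] by [m],
   and [b n T_n], from differentiating [T_m], whose derivative is 1. *)
transitivity ((lambda ^ m * lambda ^ n)%:MP * f0
  * (((m%:~R)%:MP * poly_in_t (T m) + (b * n%:~R)%:MP * poly_in_t (T n))
     - (m%:~R + n%:~R * b)%:MP * poly_in_t (T (m + n)))); first by ring.
by rewrite E subrr mulr0.
Qed.

Hypothesis h_cond : forall n m,
  m%:~R *: h m - n%:~R *: h n
  + b *: (n%:~R *: (T n * (h m)^`()) - m%:~R *: (T m * (h n)^`()))
  = (m - n)%:~R *: h (m + n).

Let h_condM n m :
  (m%:~R)%:MP * poly_in_t (h m) - (n%:~R)%:MP * poly_in_t (h n)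
  + b%:MP * ((n%:~R)%:MP * (poly_in_t (T n) * poly_in_t (h m)^`())
             - (m%:~R)%:MP * (poly_in_t (T m) * poly_in_t (h n)^`()))
  = ((m - n)%:~R)%:MP * poly_in_t (h (m + n)).
Proof.
rewrite -[RHS]poly_in_tZ -h_cond.
by rewrite poly_in_tD !poly_in_tZ !poly_in_tB !poly_in_tZ !poly_in_tM.
Qed.

Let opL_opLE n m f (f0 := shift_s (n + m) f) (f1 := dt f0) :
  opL n (opL m f)
  = lambda ^ n *: ((s_var F + poly_in_t (h n))
      * (lambda ^ m *: ((s_var F - (n%:~R)%:MP + poly_in_t (h m)) * f0)
         + (b * m%:~R * lambda ^ m) *: (poly_in_t (T m) * f1)))
    + (b * n%:~R * lambda ^ n) *: (poly_in_t (T n)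
      * (lambda ^ m *: (poly_in_t (h m)^`() * f0
           + (s_var F - (n%:~R)%:MP + poly_in_t (h m)) * f1)
         + (b * m%:~R * lambda ^ m) *: (f1 + poly_in_t (T m) * dt f1))).
Proof. by rewrite {1}/opL dt_shift_opL shift_opL. Qed.

(** Both products are expanded in [f0], [f1], [f2]. In the coefficient of [f0], the difference of
    [(s + h_n)(s - n + h_m)] and its mirror image is [(m - n) s + m h_m - n h_n]; the relation for
    [h] absorbs the rest. *)
Lemma opL_opL n m f :
  opL n (opL m f) - opL m (opL n f) = (m - n)%:~R *: opL (m + n) f.
Proof.
have E := h_condM n m; have E1 := T_condM n m; have E2 := T_condM m n.
apply: etrans (congr2 (fun x y => x - y) (opL_opLE n m f) (opL_opLE m n f)) _.
rewrite /opL; rewrite [n + m]addrC in E2 *.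
rewrite expfzDr // -!mul_mpolyC.
apply: (@subr0_eq M).
set f0 := shift_s _ f; set f1 := dt f0.
set f2 := dt f1.
(* The coefficient of [f1] is [m] times the relation for [T] at [(n, m)] minus
   [n] times the one at [(m, n)]; the coefficients of [f2] cancel. *)
transitivity ((lambda ^ m * lambda ^ n)%:MP
  * (f0 * ((m%:~R)%:MP * poly_in_t (h m) - (n%:~R)%:MP * poly_in_t (h n)
  + b%:MP * ((n%:~R)%:MP * (poly_in_t (T n) * poly_in_t (h m)^`())
             - (m%:~R)%:MP * (poly_in_t (T m) * poly_in_t (h n)^`()))
    - ((m - n)%:~R)%:MP * poly_in_t (h (m + n)))
  + b%:MP * f1 * ((m%:~R)%:MP *
      (((m%:~R)%:MP * poly_in_t (T m) + (b * n%:~R)%:MP * poly_in_t (T n))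
        - (m%:~R + n%:~R * b)%:MP * poly_in_t (T (m + n)))
     - (n%:~R)%:MP *
      (((n%:~R)%:MP * poly_in_t (T n) + (b * m%:~R)%:MP * poly_in_t (T m))
        - (n%:~R + m%:~R * b)%:MP * poly_in_t (T (m + n)))))).
  by ring.
by rewrite E E1 E2 !subrr !mulr0 subrr mulr0 addr0 mulr0.
Qed.

Lemma extend_act_ops_lie_module (a : vir_basis b -> M -> M) :
  (forall m, a (bL m) =1 opL m) -> (forall m, a (bW m) =1 opW m) ->
  (forall i f, a (bC i) f = 0) -> is_lie_module (extend_act a).
Proof.
move=> aL aW aC; apply: vir_module_of_basis => //.
- case=> [m|m|i] c f g; first by rewrite !aL opL_linear.
    by rewrite !aW opW_linear.
  by rewrite !aC scaler0 addr0.
- by move=> n m f; rewrite !aL opL_opL.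
- by move=> n m f; rewrite !(aL, aW) opL_opW.
- by move=> n m f; rewrite !aW opW_comm.
Qed.

End Operators.

(** * The relations for the concrete families [T] and [h] *)

Section Coefficients.

Variables (F : numFieldType) (b alpha : F).

Definition t_shifted_poly (m : int) : {poly F} :=
  'X - ((b == -1)%:R * m%:~R * alpha)%:P
  - ((b == 1)%:R * (1 - (m == 0)%:R) * alpha)%:P.

Lemma t_shiftedE m : t_shifted b alpha m = poly_in_t (t_shifted_poly m).
Proof. by rewrite !poly_in_tB poly_in_tX !poly_in_tE. Qed.

Lemma deriv_t_shifted_poly m : (t_shifted_poly m)^`() = 1.
Proof. by rewrite !derivB derivX !derivC !subr0. Qed.

Lemma m1_neq1 : (-1 == 1 :> F) = false.
Proof. by rewrite eq_sym -addr_eq0 -mulr2n pnatr_eq0. Qed.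

Lemma t_shifted_polyE m : b != -1 -> b != 1 -> t_shifted_poly m = 'X.
Proof.
move=> /negbTE bN1 /negbTE b1.
by rewrite /t_shifted_poly bN1 b1 !mul0r !subr0.
Qed.

Lemma t_shifted_polyN1 m : b = -1 -> t_shifted_poly m = 'X - (m%:~R * alpha)%:P.
Proof.
by move=> b1; rewrite /t_shifted_poly b1 eqxx m1_neq1 !mul0r mul1r subr0.
Qed.

(** For [b = 1] the factor is [t - alpha] except at [m = 0], where it is [t]; multiplying by [m]
    hides this exception. *)
Lemma t_shifted_poly1 m :
  b = 1 -> m%:~R *: t_shifted_poly m = m%:~R *: ('X - alpha%:P).
Proof.
move=> b1; rewrite /t_shifted_poly b1 eqxx [1 == -1]eq_sym m1_neq1 !mul0r subr0.
by case: eqVneq => [->|_]; rewrite ?scale0r //= subr0 !mul1r.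
Qed.

Lemma t_shifted_poly_cond n m :
  m%:~R *: t_shifted_poly m + (b * n%:~R) *: t_shifted_poly n
  = (m%:~R + n%:~R * b) *: t_shifted_poly (m + n).
Proof.
have [b1|b1] := eqVneq b 1.
  rewrite b1 mul1r mulr1 -rmorphD /= !t_shifted_poly1 //.
  by rewrite -!mul_polyC; ring.
have [bN1|bN1] := eqVneq b (-1).
  by rewrite !t_shifted_polyN1 // bN1 -!mul_polyC; ring.
by rewrite !t_shifted_polyE // -!mul_polyC; ring.
Qed.

(** The relation between [H] and [D] is the derivative of the exact division
    [(t - alpha) d_i = t^i - alpha^i], summed with the coefficients [c i]. *)
Lemma in_H_decomp h : in_H b alpha h ->
  exists H D : {poly F}, H^`() = D^`() * ('X - alpha%:P) + D /\
    forall n, h n = n%:~R *: H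
      - ((b == -1)%:R * (n * (n - 1))%:~R * alpha) *: D
      - ((b == 1)%:R * n%:~R * alpha) *: D.
Proof.
case=> N [c hE].
pose d i : {poly F} := ('X^i - (alpha ^+ i)%:P) %/ ('X - alpha%:P).
have dE i : d i * ('X - alpha%:P) = 'X^i - (alpha ^+ i)%:P.
  apply: divpK; rewrite dvdp_XsubCl /root.
  by rewrite hornerD hornerN hornerXn hornerC subrr.
have d'E i : ('X^i : {poly F})^`() = (d i)^`() * ('X - alpha%:P) + d i.
  have := congr1 deriv (dE i).
  by rewrite derivM !derivB derivX !derivC !subr0 mulr1 => <-.
exists (\sum_(i < N) c i *: 'X^i), (\sum_(i < N) c i *: d i); split.
  rewrite !linear_sum mulr_suml -big_split /=; apply: eq_bigr => i _.
  by rewrite !derivZ d'E -scalerAl scalerDr.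
move=> n; rewrite hE !scaler_sumr -!sumrB; apply: eq_bigr => i _.
rewrite /q_poly -/(d i) !scalerBr !scalerA.
by congr (_ *: _ - _ *: _ - _ *: _); rewrite mulrC.
Qed.

Lemma in_H_cond h n m : in_H b alpha h ->
  m%:~R *: h m - n%:~R *: h n
  + b *: (n%:~R *: (t_shifted_poly n * (h m)^`())
          - m%:~R *: (t_shifted_poly m * (h n)^`()))
  = (m - n)%:~R *: h (m + n).
Proof.
case/in_H_decomp=> H [D [H'E hE]].
(* Each integer factor is moved next to its [T], the form required by [t_shifted_poly1]. For
   [b = 1], [h n] is [n] times the fixed polynomial [H - alpha D], so the derivative terms
   cancel. *)
rewrite !scalerAl; have [b1|b1] := eqVneq b 1.
  rewrite !t_shifted_poly1 // !hE b1 eqxx [1 == -1]eq_sym m1_neq1 !mul0r.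
  rewrite !scale0r !subr0 !mul1r !derivB !derivZ -!mul_polyC; ring.
have [bN1|bN1] := eqVneq b (-1).
  (* For [b = -1] the derivative terms, before the factor [b], sum to
     [n m (m - n) alpha (H' - (t - alpha) D')], which [H'E] turns into [n m (m - n) alpha D]. *)
  rewrite !t_shifted_polyN1 // !hE bN1 eqxx m1_neq1 !mul0r !scale0r !subr0.
  by rewrite !mul1r !derivB !derivZ H'E -!mul_polyC; ring.
(* Here [h n = n H] and every [T] is [t], so the derivative terms cancel again. *)
rewrite !t_shifted_polyE // !hE (negbTE b1) (negbTE bN1) !mul0r !scale0r.
by rewrite !subr0 !derivZ -!mul_polyC; ring.
Qed.

End Coefficients.

(** * The modules [Phi] and [Theta] *)

Lemma Phi_lie_module {F : numFieldType} (b lambda alpha : F)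
    (h : int -> {poly F}) :
  lambda != 0 -> in_H b alpha h -> is_lie_module (@Phi_act F b lambda alpha h).
Proof.
move=> lambda0 hH.
apply: (extend_act_ops_lie_module F b lambda (t_shifted_poly F b alpha) h).
- exact: lambda0.
- exact: deriv_t_shifted_poly.
- exact: t_shifted_poly_cond.
- by move=> n m; apply: in_H_cond.
- by move=> m f; rewrite /= t_shiftedE.
- by move=> m f; rewrite /= t_shiftedE.
- by [].
Qed.

(** [Theta] restricted to the [L_m] has the shape of [Phi] for [b = 0]. *)
Lemma Theta_lie_module {F : numFieldType} (lambda : F) (r : int -> {poly F}) :
  lambda != 0 -> in_H 1 0 r -> is_lie_module (@Theta_act F lambda r).
Proof.
move=> lambda0 rH.
have Theta_L m f : Theta_basis lambda r (bL m) f
    = opL F 0 lambda (fun=> 'X) r m f.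
  by rewrite /opL !mul0r scale0r addr0.
(* With [alpha = 0] the terms in [D] vanish and [r n = n H], so [H] is recovered as [r 1]. *)
have rE n : r n = n%:~R *: r 1.
  have [H [D [_ hE]]] := in_H_decomp _ _ _ _ rH.
  by rewrite !hE !mulr0 !scale0r !subr0 scale1r.
have Theta_W m f : Theta_basis lambda r (bW m) f
    = (m == 0)%:R *: (t_var F * shift_s m f) by [].
have Theta_C i f : Theta_basis lambda r (bC i) f = 0 by [].
apply: (vir_module_of_basis F 1 (Theta_basis lambda r)).
- case=> [m|m|i] c f g.
  + by rewrite !Theta_L opL_linear.
  + rewrite !Theta_W shift_sD shift_sZ mulrDr -scalerAr scalerDr !scalerA.
    by rewrite mulrC.
  + by rewrite !Theta_C scaler0 addr0.
- exact: Theta_C.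
- move=> n m f; rewrite !Theta_L; apply: opL_opL => //.
  + by move=> k; rewrite derivX.
  + by move=> k l; rewrite !mul0r mulr0 scale0r addr0 addr0.
  + move=> k l; rewrite scale0r addr0 (rE l) (rE k) (rE (l + k)).
    by rewrite -!mul_polyC; ring.
- move=> n m f; rewrite !Theta_W mulr1 scalerA -rmorphD /=.
  (* The required commutator is zero: [W_(m+n)] acts nontrivially only when [m + n = 0], where its
     coefficient vanishes. *)
  have -> : (m + n)%:~R * (m + n == 0)%:R = 0 :> F.
    by case: eqVneq => [->|_]; rewrite ?mul0r ?mulr0.
  rewrite scale0r; apply/eqP; rewrite subr_eq0; apply/eqP.
  (* For nonzero [m], [W_m] acts as zero. [W_0] is multiplication by [t], which commutes with [L_n]
     because the shift fixes [t]. *)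
  have [->|_] := eqVneq m 0; last first.
    by rewrite !scale0r /= /shift_s comp_mpoly0 mulr0 scaler0.
  rewrite !scale1r !shift_s0 /= shift_sM shift_s_t -scalerAr.
  by rewrite mulrCA.
- move=> n m f; rewrite !Theta_W !shift_sZ !shift_sM !shift_s_t.
  rewrite !shift_s_shift_s [m + n]addrC -!scalerAr !scalerA.
  by rewrite [_%:R * _%:R]mulrC.
Qed.

Theorem proposition2p2 (R : realType) (b : R[i]) :
  (forall (lambda alpha : R[i]) (h : int -> {poly R[i]}),
     lambda != 0 -> in_H b alpha h ->
     is_lie_module (@Phi_act R[i] b lambda alpha h)) /\
  (forall (lambda : R[i]) (r : int -> {poly R[i]}),
     lambda != 0 -> in_H 1 0 r ->
     is_lie_module (@Theta_act R[i] lambda r)).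
Proof.
split=> [lambda alpha h|lambda r]; first exact: Phi_lie_module.
exact: Theta_lie_module.
Qed.
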